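(* Let $\alpha,\beta>0$ be constants such that for every $n$, every pair $(X_0,Y_0)$ of partitions of $n$ with $\rho(X_0,Y_0)=1$, and every integer $t\ge \alpha n$, the coupled process $(X_t,Y_t)$ defined in the context satisfies $\mathbb{E}[s(X_t,Y_t)]\ge \beta n$. Then for every $n$ and every starting pair with $\rho(X_0,Y_0)=1$, $$\mathbb{P}\left(X_{T}=Y_{T}\right)\ge \beta,\qquad T=\lceil\alpha n\rceil+\lceil n/2\rceil .$$
   Context: Split-merge random walk. Let $\mathcal P_n$ be the set of partitions of $n$ (multisets of positive integers summing to $n$). From a partition with parts $a_1,\dots,a_m$ the walk makes one of the following moves. Split: for each $i$ and each integer $1\le r<a_i/2$, replace $a_i$ by the parts $r,a_i-r$ with probability $2a_i/n^2$; if $a_i$ is even and $r=a_i/2$, replace $a_i$ by $r,r$ with probability $a_i/n^2$. Merge: for each $i<j$, replace $a_i,a_j$ by $a_i+a_j$ with probability $2a_ia_j/n^2$. Stay in place with probability $1/n$. Distance and $s,m$. $\rho(\sigma,\tau)$ is the minimal number of split or merge moves needed to get from $\sigma$ to $\tau$. If $\rho(\sigma,\tau)=1$ then, up to exchanging the two, $\sigma=(a_1,\dots,a_m,b,c)$ and $\tau=(a_1,\dots,a_m,b+c)$ with $b\le c$; put $s(\sigma,\tau)=s(\tau,\sigma)=b$ and $m(\sigma,\tau)=m(\tau,\sigma)=c$. Also $s(\sigma,\sigma)=n/2$ and $m(\sigma,\sigma)=n$. Coupling. $(X_t,Y_t)_{t\ge0}$ is the Markov chain on pairs of partitions at distance at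 most $1$, both marginals being split-merge random walks, with the following one-step law. If $X_t=Y_t$ the two copies move together. If $\{X_t,Y_t\}=\{\sigma,\tau\}$ with $\sigma=(a_1,\dots,a_m,b,c)$, $\tau=(a_1,\dots,a_m,b+c)$, $b\le c$ (whichever of $X_t,Y_t$ has more parts plays the role of $\sigma$), the moves in $\sigma$ and $\tau$ are paired as follows. (1) Any merge of some $a_i,a_j$ or split of some $a_i$ in $\sigma$ is paired with the same move in $\tau$. (2) Merging $b$ with $a_i$ in $\sigma$, and merging $c$ with $a_i$ in $\sigma$, are both paired with merging $b+c$ with $a_i$ in $\tau$. (3) Splitting $b$ into $\{r,b-r\}$ with $r\le b/2$ in $\sigma$, and splitting $c$ into $\{r,c-r\}$ with $r\le c/2$ in $\sigma$, are each paired with splitting $b+c$ into $\{r,b+c-r\}$ in $\tau$. (4) Let $p$ be the probability of splitting $b+c$ into $\{b,c\}$ in $\tau$ minus the part of it already used in (3). With probability $\min(p,1/n)$, $\sigma$ stays in place and $\tau$ splits $b+c$ into $\{b,c\}$; with probability $1/n-\min(p,1/n)$ both stay in place. (5) Merging $b$ and $c$ in $\sigma$ is paired with all the remaining probability of the moves of $\tau$ (staying in place, or splitting $b+c$ into $\{r,b+c-r\}$). *)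

(* Defs.v *)
From HB Require Import structures.
From mathcomp Require Import all_boot all_order all_algebra.

Set Implicit Arguments.
Unset Strict Implicit.
Unset Printing Implicit Defensive.

Import Order.TTheory GRing.Theory Num.Theory.
Local Open Scope ring_scope.

(* A multiset of positive integers is represented by its unique nonincreasing
   enumeration, so that Leibniz equality is equality of partitions. *)
Definition is_intpart (n : nat) (s : seq nat) : bool :=
  [&& sorted geq s, 0%N \notin s & sumn s == n].

Record intpart (n : nat) : Type :=
  IntPart { parts :> seq nat; intpartP : is_intpart n parts }.

HB.instance Definition _ (n : nat) := [isSub for @parts n].
HB.instance Definition _ (n : nat) := [Countable of intpart n by <:].

Definition intpart_code (n : nat) (x : intpart n) : {ffun 'I_n -> 'I_n.+1} :=
  [ffun i : 'I_n => inord (nth 0%N x i)].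

Definition intpart_decode (n : nat) (f : {ffun 'I_n -> 'I_n.+1}) :
    option (intpart n) :=
  insub [seq k <- [seq val (f i) | i <- enum 'I_n] | k != 0%N].

Lemma size_le_sumn (s : seq nat) : 0%N \notin s -> (size s <= sumn s)%N.
Proof.
elim: s => //= a s IHs; rewrite inE negb_or eq_sym -lt0n => /andP[a0 /IHs le_s].
by rewrite -add1n leq_add.
Qed.

Lemma mem_le_sumn (s : seq nat) (a : nat) : a \in s -> (a <= sumn s)%N.
Proof. by move=> /perm_to_rem /perm_sumn ->; rewrite /= leq_addr. Qed.

Lemma intpart_codeK (n : nat) : pcancel (@intpart_code n) (@intpart_decode n).
Proof.
move=> x; have /and3P[_ x0 /eqP sx] := intpartP x.
suff -> : intpart_decode (intpart_code x) = insub (parts x) by rewrite valK.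
have szx : (size x <= n)%N by rewrite -[leqRHS]sx size_le_sumn.
congr insub; have -> : [seq val (intpart_code x i) | i <- enum 'I_n]
                       = mkseq (nth 0%N x) n.
  rewrite /mkseq -val_enum_ord -map_comp; apply: eq_map => i /=.
  rewrite ffunE inordK // ltnS; have [ltix|] := ltnP i (size x).
    by rewrite -[leqRHS]sx mem_le_sumn // mem_nth.
  by move=> ?; rewrite nth_default.
have -> : mkseq (nth 0%N x) n = x ++ nseq (n - size x) 0%N.
  apply: (@eq_from_nth _ 0%N).
    by rewrite size_mkseq size_cat size_nseq subnKC.
  move=> i; rewrite size_mkseq => ltin; rewrite nth_mkseq // nth_cat nth_nseq.
  by case: ltnP => // ?; rewrite nth_default // if_same.
rewrite filter_cat (eq_in_filter (a2 := predT)); last first.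
  by move=> k kx /=; apply: contraNneq x0 => <-.
rewrite filter_predT -[RHS]cats0; congr (_ ++ _).
by elim: (n - size x)%N.
Qed.

HB.instance Definition _ (n : nat) : isFinite (intpart n) :=
  PCanIsFinite (@intpart_codeK n).

(* [unmerge sg tu = Some (b, c, A)] when sg = (A, b, c), tu = (A, b + c) and
   b <= c; then b, c and A are uniquely determined up to the order of A.  It is
   [None] when tu is not obtained from sg by one merge. *)
Definition unmerge (sg tu : seq nat) : option (nat * nat * seq nat) :=
  ohead [seq u <- [seq (b, c, rem c (rem b sg)) | b <- sg, c <- sg]
        | let: (b, c, A) := u in
          [&& (b <= c)%N, perm_eq sg [:: b, c & A]
            & perm_eq tu ((b + c)%N :: A)]].

(* tu is obtained from sg by one merge, or by one split. *)
Definition move (n : nat) (sg tu : intpart n) : bool :=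
  unmerge sg tu || unmerge tu sg.

Definition reach (n k : nat) (sg tu : intpart n) : bool :=
  [exists p : k.-tuple (intpart n), path (@move n) sg p && (last sg p == tu)].

Lemma unmerge_perm (b c : nat) (A sg tu : seq nat) :
  perm_eq sg [:: b, c & A] -> perm_eq tu ((b + c)%N :: A) -> unmerge sg tu.
Proof.
wlog lebc : b c / (b <= c)%N => [IH|] sgE tuE.
  have [lebc|ltcb] := leqP b c; first exact: (IH b c).
  apply: (IH c b) (ltnW ltcb) _ _; last by rewrite addnC.
  by rewrite (perm_trans sgE) //; apply/permP => P /=; rewrite addnCA.
rewrite /unmerge; set l := [seq _ <- _ | _].
suff : (b, c, rem c (rem b sg)) \in l by case: l.
have AE : perm_eq (rem c (rem b sg)) A.
  have E1 : perm_eq (rem b sg) (c :: A).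
    rewrite -(perm_cons b) -(permPr sgE) perm_sym perm_to_rem //.
    by rewrite (perm_mem sgE) inE eqxx.
  rewrite -(perm_cons c) -(permPr E1) perm_sym perm_to_rem //.
  by rewrite (perm_mem E1) inE eqxx.
rewrite mem_filter lebc (perm_trans sgE) ?(perm_trans tuE) /=.
- by apply/allpairsP; exists (b, c); rewrite /= !(perm_mem sgE) !inE !eqxx orbT.
- by rewrite perm_cons perm_sym.
- by rewrite !perm_cons perm_sym.
Qed.

Lemma connect_single (n : nat) (x y : intpart n) :
  (size y <= 1)%N -> connect (@move n) x y.
Proof.
move=> y1; have [m] := ubnP (size x); elim: m x => // m IHm x.
case xE: (parts x) => [|b [|c A]] szx; last first.
  have xP := intpartP x; rewrite xE in xP.
  have zP : is_intpart n (sort geq ((b + c)%N :: A)).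
    case/and3P: xP => _ x0 /eqP <-; rewrite /is_intpart.
    rewrite sort_sorted; last by move=> i j; apply: leq_total.
    rewrite mem_sort (perm_sumn (permEl (perm_sort _ _))) /= addnA eqxx andbT.
    move: x0; rewrite !inE !negb_or => /and3P[b0 _ ->].
    by rewrite andbT eq_sym addn_eq0 eq_sym (negPf b0).
  apply: connect_trans (connect1 _) (IHm (IntPart zP) _).
    by rewrite /move (@unmerge_perm b c A) //= ?xE // perm_sort.
  by rewrite /= size_sort.
all: suff -> : x = y by [].
all: apply: val_inj; have := intpartP x; have := intpartP y; rewrite /= xE.
all: case: (parts y) y1 => [|a [|//]] _ //; rewrite /is_intpart /= inE ?addn0.
- by move=> /eqP <-; rewrite eq_sym => /andP[/negPf ->].
- by move=> /andP[_ /eqP ->] /andP[_ /eqP ->].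
- by move=> /andP[/[swap] /eqP -> /negPf ->].
Qed.

Lemma reach_ex (n : nat) (sg tu : intpart n) : exists k, reach k sg tu.
Proof.
have [o o1] : exists o : intpart n, (size o <= 1)%N.
  have oP : is_intpart n (if n is 0 then [::] else [:: n]).
    by case: n {sg tu} => //= k; rewrite /is_intpart /= addn0 eqxx.
  by exists (IntPart oP); case: (n) oP.
have move_sym : connect_sym (@move n).
  by apply: sym_connect_sym => x y; rewrite /move orbC.
have /connectP[p pP ->] : connect (@move n) sg tu.
  by rewrite (connect_trans (connect_single _ o1)) // move_sym connect_single.
by exists (size p); apply/existsP; exists (in_tuple p); rewrite /= pP eqxx.
Qed.

Definition rho (n : nat) (sg tu : intpart n) : nat := ex_minn (reach_ex sg tu).

(* For a partition outside distance 1 the value is irrelevant. *)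
Definition sdist (R : realFieldType) (n : nat) (sg tu : intpart n) : R :=
  if sg == tu then n%:R / 2
  else if unmerge sg tu is Some (b, _, _) then b%:R
  else if unmerge tu sg is Some (b, _, _) then b%:R
  else 0.

(* Probability of splitting a given part a into {r, a - r}; r >= 1 throughout. *)
Definition splitp (R : realFieldType) (n a r : nat) : R :=
  if (r.*2 < a)%N then (a.*2)%:R / n%:R ^+ 2
  else if (r.*2 == a)%N then a%:R / n%:R ^+ 2
  else 0.

(* Probability of merging two given parts a and b. *)
Definition mergep (R : realFieldType) (n a b : nat) : R :=
  (2 * a * b)%:R / n%:R ^+ 2.

Definition stayp (R : realFieldType) (n : nat) : R := n%:R^-1.

(* Finite laws are lists of pairs (probability, outcome); an outcome may be
   listed several times, and outcomes are unsorted lists of parts.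
   [moves R n A] lists the moves of the walk on partitions of n that split or
   merge parts of A, parts being distinguished by their position; A may be
   only a part of a partition of n. *)
Definition moves (R : realFieldType) (n : nat) (A : seq nat) :
    seq (R * seq nat) :=
  [seq (splitp R n a r, [:: r, (a - r)%N & rem a A])
     | a <- A, r <- iota 1 a./2]
  ++ [seq let: (a, b) := (nth 0%N A i, nth 0%N A j) in
          (mergep R n a b, (a + b)%N :: rem b (rem a A))
     | i <- iota 0 (size A), j <- iota i.+1 (size A - i.+1)].

Definition walk (R : realFieldType) (n : nat) (A : seq nat) :
    seq (R * seq nat) :=
  (stayp R n, A) :: moves R n A.

(* One step of the coupling from sg = (A, b, c) and tu = (A, b + c), b <= c,
   with outcomes (new sg, new tu).  [used r] is the probability of the splitting
   of b + c into {r, b + c - r} in tu that is paired with splittings of b or c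
   in sg, and q is the probability that sg stays in place while tu splits
   b + c into {b, c}.  The entries with first component tu are the merging of
   b and c in sg; their weights are what is left of the probabilities of the
   moves of tu, and they add up to mergep R n b c. *)
Definition couple (R : realFieldType) (n b c : nat) (A : seq nat) :
    seq (R * (seq nat * seq nat)) :=
  let sg := [:: b, c & A] in
  let tu := (b + c)%N :: A in
  let tu_split r := [:: r, (b + c - r)%N & A] in
  let used r := splitp R n b r + splitp R n c r in
  let p := splitp R n (b + c) b - used b in
  let q := Num.min p (stayp R n) in
  [seq (w.1, ([:: b, c & w.2], (b + c)%N :: w.2)) | w <- moves R n A]
  ++ [seq (mergep R n b a,
           ([:: (b + a)%N, c & rem a A], (b + c + a)%N :: rem a A)) | a <- A]
  ++ [seq (mergep R n c a,
           ([:: b, (c + a)%N & rem a A], (b + c + a)%N :: rem a A)) | a <- A]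
  ++ [seq (splitp R n b r, ([:: r, (b - r)%N, c & A], tu_split r))
     | r <- iota 1 b./2]
  ++ [seq (splitp R n c r, ([:: b, r, (c - r)%N & A], tu_split r))
     | r <- iota 1 c./2]
  ++ [:: (q, (sg, tu_split b)); (stayp R n - q, (sg, tu))]
  ++ (stayp R n - (stayp R n - q), (tu, tu))
  :: [seq (splitp R n (b + c) r - used r - (if r == b then q else 0),
           (tu, tu_split r))
     | r <- iota 1 (b + c)./2].

(* One step of the coupled chain.  Pairs at distance at least 2 are never
   visited from a pair at distance at most 1; they are made absorbing. *)
Definition coupled_step (R : realFieldType) (n : nat) (x y : seq nat) :
    seq (R * (seq nat * seq nat)) :=
  if x == y then [seq (w.1, (w.2, w.2)) | w <- walk R n x]
  else if unmerge x y is Some (b, c, A) then couple R n b c A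
  else if unmerge y x is Some (b, c, A) then
    [seq (w.1, (w.2.2, w.2.1)) | w <- couple R n b c A]
  else [:: (1, (x, y))].

Definition kernel (R : realFieldType) (n : nat)
    (z z' : intpart n * intpart n) : R :=
  \sum_(w <- coupled_step R n z.1 z.2
        | perm_eq w.2.1 z'.1 && perm_eq w.2.2 z'.2) w.1.

(* law R z t z' is the probability that (X_t, Y_t) = z' when (X_0, Y_0) = z. *)
Fixpoint law (R : realFieldType) (n : nat) (z : intpart n * intpart n)
    (t : nat) (z' : intpart n * intpart n) : R :=
  if t is t'.+1 then \sum_u law R z t' u * kernel R u z'
  else (z' == z)%:R.

Definition Prob (R : realFieldType) (n : nat) (z : intpart n * intpart n)
    (t : nat) (E : pred (intpart n * intpart n)) : R :=
  \sum_(z' | E z') law R z t z'.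

Definition Expect (R : realFieldType) (n : nat) (z : intpart n * intpart n)
    (t : nat) (f : intpart n * intpart n -> R) : R :=
  \sum_z' law R z t z' * f z'.

(* Main.v *)
(** Let p_t = P(X_t = Y_t), an absorbing event. From an uncoupled pair with
    smaller part b, case (4) makes the two copies meet with probability
    q = min(p, 1/n) >= 2b/n^2, both when sigma stays and tau splits b + c into
    {b, c}, and when sigma merges b and c while tau stays. Hence
    p_(t+1) - p_t >= (4/n^2) (E[s_t] - p_t n/2) >= (2/n) (2 beta - p_t)
    for t >= alpha n, so that p gains at least 2 beta/n per step until it has
    reached beta. *)
Require Import Defs.
From mathcomp Require Import all_boot all_order all_algebra.
From mathcomp Require Import reals.
From mathcomp Require Import zify ring lra.

Set Implicit Arguments.
Unset Strict Implicit.
Unset Printing Implicit Defensive.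

Import Order.TTheory GRing.Theory Num.Theory.
Local Open Scope ring_scope.

(** * Partitions as lists up to permutation *)

Lemma unmergeP (sg tu : seq nat) (b c : nat) (A : seq nat) :
  unmerge sg tu = Some (b, c, A) ->
  [/\ (b <= c)%N, perm_eq sg [:: b, c & A] & perm_eq tu ((b + c)%N :: A)].
Proof.
rewrite /unmerge; set l := [seq _ <- _ | _] => lE.
have : (b, c, A) \in l by case: l lE => //= u l [->]; rewrite inE eqxx.
by rewrite mem_filter => /andP[/and3P[]].
Qed.

(** This is [is_intpart] without sortedness: outcomes of moves are unsorted, so the condition has to
    be invariant under permutation. *)
Definition proper_parts (n : nat) (s : seq nat) : bool :=
  (0%N \notin s) && (sumn s == n).

Lemma perm_proper_parts (n : nat) (s t : seq nat) :
  perm_eq s t -> proper_parts n s = proper_parts n t.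
Proof. by move=> st; rewrite /proper_parts (perm_mem st) (perm_sumn st). Qed.

Lemma intpart_proper (n : nat) (x : intpart n) : proper_parts n x.
Proof. by have /and3P[_ x0 sx] := intpartP x; apply/andP. Qed.

Lemma properP (n : nat) (s : seq nat) :
  proper_parts n s -> exists x : intpart n, perm_eq s x.
Proof.
move=> sP; have s'P : is_intpart n (sort geq s).
  rewrite /is_intpart sort_sorted => [|i j]; last exact: leq_total.
  rewrite -[_ && _]/(proper_parts n (sort geq s)).
  by rewrite (perm_proper_parts _ (permEl (perm_sort _ _))).
by exists (IntPart s'P); rewrite perm_sym /= perm_sort.
Qed.

(** * Weights of splits and merges, and the total mass of the moves *)

(** The split probability times n^2, kept in [nat] so that inequalities between weights fall to
    [lia]. *)
Definition splitw (a r : nat) : nat :=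
  if (r.*2 < a)%N then a.*2 else if r.*2 == a then a else 0.

Lemma splitpE (R : realFieldType) (n a r : nat) :
  splitp R n a r = (splitw a r)%:R / n%:R ^+ 2.
Proof. by rewrite /splitp /splitw; do 2!case: ifP => //; rewrite mul0r. Qed.

(** If the left side is nonzero, then r is at most b/2 or c/2, hence r < (b + c)/2, and the right
    side is the full 2(b + c). *)
Lemma splitwD (b c r : nat) :
  (0 < b)%N -> (0 < c)%N -> (splitw b r + splitw c r <= splitw (b + c) r)%N.
Proof. by rewrite /splitw => b0 c0; repeat case: ifP; lia. Qed.

(** A part b has no split at r = b. For b < c the right side is 2b + 2c and c uses at most 2c of it;
    for b = c both sides equal 2b. *)
Lemma splitw_gap (b c : nat) : (0 < b <= c)%N ->
  (2 * b + (splitw b b + splitw c b) <= splitw (b + c) b)%N.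
Proof. by rewrite /splitw => bc; repeat case: ifP; lia. Qed.

(** Every r < a/2 weighs 2a; for even a the last r = a/2 weighs only a. Either way the total is a(a
    - 1). *)
Lemma sum_splitw (a : nat) :
  (\sum_(r <- iota 1 a./2) splitw a r + a = a * a)%N.
Proof.
have full k : (k.*2 < a)%N -> (\sum_(r <- iota 1 k) splitw a r = k * a.*2)%N.
  move=> ka; rewrite big_seq (eq_bigr (fun=> a.*2)) => [|r]; last first.
    by rewrite mem_iota /splitw => rk; case: ifP => //; lia.
  by rewrite -big_seq big_const_seq count_predT size_iota iter_addn_0 mulnC.
case: (posnP a) => [->|a0]; first by rewrite big_nil.
have [oa|ea] := boolP (odd a); first by rewrite full; nia.
have -> : a./2 = (a./2.-1 + 1)%N by lia.
rewrite iotaD big_cat big_seq1 full; last by lia.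
set k := a./2.-1; have -> : a = k.+1.*2 by rewrite /k; lia.
by rewrite /splitw add1n ltnn eqxx /=; nia.
Qed.

(** The square of the sum of the parts, expanded into cross terms and squares. *)
Lemma sum_pairs (A : seq nat) :
  (\sum_(i <- iota 0 (size A)) \sum_(j <- iota i.+1 (size A - i.+1))
     2 * nth 0 A i * nth 0 A j + \sum_(a <- A) a * a = sumn A * sumn A)%N.
Proof.
have shift m k (F : nat -> nat) :
    (\sum_(j <- iota m.+1 k) F j = \sum_(j <- iota m k) F j.+1)%N.
  by rewrite (iotaDl 1 m) big_map.
elim: A => [|a A IH]; first by rewrite !big_nil.
rewrite [iota _ _]/= !big_cons !shift /=.
under [X in (_ + X + _)%N]eq_bigr => i _ do rewrite subSS shift /=.
rewrite subn1 /= -big_distrr /=.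
have -> : (\sum_(i <- iota 0 (size A)) nth 0 A i = sumn A)%N.
  by rewrite sumnE [RHS](big_nth 0%N) /index_iota subn0.
by nia.
Qed.

(** Up to the factor 1/n^2, splits contribute the sum of a^2 - a and merges the square of the sum
    minus the sum of a^2; the a^2 cancel. *)
Lemma sum_moves (R : realFieldType) (n : nat) (A : seq nat) :
  \sum_(w <- moves R n A) w.1
    = ((sumn A)%:R ^+ 2 - (sumn A)%:R) / n%:R ^+ 2.
Proof.
rewrite /moves big_cat !big_allpairs_dep /=.
under eq_bigr => a _.
  under eq_bigr do rewrite splitpE.
  rewrite -mulr_suml -natr_sum; over.
under [X in _ + X]eq_bigr => i _.
  rewrite -mulr_suml -natr_sum; over.
rewrite -!mulr_suml -mulrDl; congr (_ / _).
rewrite -!natr_sum -natrD -natrX; apply/eqP.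
rewrite -subr_eq0 opprB addrA -natrD subr_eq0 eqr_nat; apply/eqP.
rewrite -mulnn -(sum_pairs A).
under [X in (_ = _ + X)%N]eq_bigr do rewrite -sum_splitw.
by rewrite big_split /= -sumnE; lia.
Qed.

(** * Nonnegative weights and proper outcomes *)

Lemma all_ge0_moves (R : realFieldType) (n : nat) (A : seq nat) :
  all (fun w => 0 <= w.1) (moves R n A).
Proof.
rewrite all_cat.
apply/andP; split; apply/allP => w /allpairsPdep[a [r [_ _ ->]]].
  by rewrite /= splitpE divr_ge0 // exprn_ge0.
by rewrite /= divr_ge0 // exprn_ge0.
Qed.

Lemma perm_two (A : seq nat) (i j : nat) : (i < j < size A)%N ->
  perm_eq A [:: nth 0 A i, nth 0 A j & rem (nth 0 A j) (rem (nth 0 A i) A)]%N.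
Proof.
case/andP=> ij jA; set a := nth 0%N A i; set b := nth 0%N A j => /=.
have aA : a \in A by rewrite mem_nth // (ltn_trans ij).
rewrite (perm_trans (perm_to_rem aA)) // perm_cons perm_to_rem //.
(* Since i < j, a copy of [a] precedes position j; hence if both values coincide, removing one copy
   leaves another. *)
have a_take : a \in take j A.
  by rewrite /a -(nth_take _ ij) mem_nth // size_take jA.
rewrite -has_pred1 has_count count_mem_rem subn_gt0.
rewrite -(cat_take_drop j A) count_cat (drop_nth 0%N) //= eqxx.
by case: eqP => [<-|_]; move: a_take; rewrite -has_pred1 has_count /=; lia.
Qed.

Lemma proper_walk (R : realFieldType) (n : nat) (A : seq nat) :
  proper_parts n A -> all (fun w => proper_parts n w.2) (walk R n A).
Proof.
move=> AP; rewrite /= AP all_cat /=.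
apply/andP; split; apply/allP => w /allpairsPdep[].
  move=> a [r [aA]]; rewrite mem_iota => rI -> /=.
  move: AP; rewrite (perm_proper_parts _ (perm_to_rem aA)).
  by rewrite /proper_parts /= !inE; lia.
move=> i [j []]; rewrite !mem_iota => iI jI -> /=.
have ij : (i < j < size A)%N by lia.
move: AP; rewrite (perm_proper_parts _ (perm_two ij)).
by rewrite /proper_parts /= !inE; lia.
Qed.

(* The weight q in [couple]. *)
Definition coal (R : realFieldType) (n b c : nat) : R :=
  Num.min (splitp R n (b + c) b - (splitp R n b b + splitp R n c b))
          (stayp R n).

(** The first term of the minimum is bounded by [splitw_gap], the second because b <= c and b + c <=
    n give 2b <= n. *)
Lemma coal_ge (R : realFieldType) (n b c : nat) :
  (0 < b <= c)%N -> (b + c <= n)%N -> (2 * b)%:R / n%:R ^+ 2 <= coal R n b c.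
Proof.
move=> bc bcn; have n0 : 0 < n%:R :> R by rewrite ltr0n; lia.
rewrite le_min !splitpE -mulrDl -mulrBl ler_pM2r ?invr_gt0 ?exprn_gt0 //.
rewrite lerBrDr -!natrD ler_nat splitw_gap //=.
rewrite /stayp ler_pdivrMr ?exprn_gt0 // expr2 mulKf ?gt_eqF // ler_nat.
by lia.
Qed.

Lemma all_ge0_couple (R : realFieldType) (n b c : nat) (A : seq nat) :
  (0 < b <= c)%N -> (b + c <= n)%N ->
  all (fun w => 0 <= w.1) (couple R n b c A).
Proof.
move=> bc bcn.
have q0 : 0 <= coal R n b c.
  by apply: le_trans (coal_ge _ bc bcn); rewrite divr_ge0 // exprn_ge0.
have split0 a r : 0 <= splitp R n a r by rewrite splitpE divr_ge0 // exprn_ge0.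
have merge0 a d : 0 <= mergep R n a d by rewrite divr_ge0 // exprn_ge0.
rewrite /couple -/(coal R n b c) !all_cat /= !all_map.
rewrite all_ge0_moves subKr q0 subr_ge0 ge_min lexx orbT !andTb.
do ![apply/andP; split]; apply/allP => r //= rI.
(* The leftover weights of case (5): at r = b the weight is p - min(p, 1/n), elsewhere [splitwD]
   applies. *)
rewrite !splitpE; case: eqP => [->|_].
  by rewrite subr_ge0 -!splitpE ge_min lexx.
rewrite subr0 -mulrDl -mulrBl divr_ge0 ?exprn_ge0 // subr_ge0 -natrD ler_nat.
by rewrite splitwD; lia.
Qed.

Lemma unmerge_proper (n : nat) (x y : intpart n) (b c : nat) (A : seq nat) :
  unmerge x y = Some (b, c, A) ->
  [/\ (0 < b <= c)%N, (b + c <= n)%N, proper_parts n [:: b, c & A]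
    & proper_parts n ((b + c)%N :: A)].
Proof.
case/unmergeP=> bc xE yE.
rewrite -(perm_proper_parts _ xE) -(perm_proper_parts _ yE) !intpart_proper.
have := intpart_proper x; rewrite (perm_proper_parts _ xE) /proper_parts /= !inE.
by move=> xP; split; lia.
Qed.

Lemma all_ge0_step (R : realFieldType) (n : nat) (x y : intpart n) :
  all (fun w => 0 <= w.1) (coupled_step R n x y).
Proof.
rewrite /coupled_step; case: ifP => _.
  by rewrite all_map /= invr_ge0 ler0n /=; apply: all_ge0_moves.
case xyE : (unmerge x y) => [[[b c] A]|].
  by have [? ? _ _] := unmerge_proper xyE; apply: all_ge0_couple.
case yxE : (unmerge y x) => [[[b c] A]|]; last by rewrite /= ler01.
by have [? ? _ _] := unmerge_proper yxE; rewrite all_map; apply: all_ge0_couple.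
Qed.

Lemma kernel_ge0 (R : realFieldType) (n : nat) (z z' : intpart n * intpart n) :
  0 <= kernel R z z'.
Proof.
rewrite /kernel big_seq_cond sumr_ge0 // => w /andP[wS _].
exact: (allP (all_ge0_step R z.1 z.2)).
Qed.

Lemma law_ge0 (R : realFieldType) (n : nat) (z : intpart n * intpart n) t z' :
  0 <= law R z t z'.
Proof.
elim: t z' => [|t IH] z' /=; first exact: ler0n.
by apply: sumr_ge0 => u _; rewrite mulr_ge0 ?kernel_ge0.
Qed.

(** * One-step probability of being on the diagonal *)

Definition meet_outcome (n : nat) (u : seq nat * seq nat) : bool :=
  proper_parts n u.1 && perm_eq u.1 u.2.

Definition diagonal (n : nat) : pred (intpart n * intpart n) :=
  fun z => z.1 == z.2.

Lemma kernel_diagonal_ge (R : realFieldType) (n : nat)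
    (z : intpart n * intpart n) :
  \sum_(w <- coupled_step R n z.1 z.2 | meet_outcome n w.2) w.1
    <= \sum_(z' | diagonal z') kernel R z z'.
Proof.
rewrite /kernel; under [leRHS]eq_bigr do rewrite big_mkcond.
rewrite exchange_big /= big_mkcond big_seq [leRHS]big_seq.
apply: ler_sum => w /(allP (all_ge0_step R z.1 z.2)) /= w0.
have nonneg (P : bool) : 0 <= (if P then w.1 else 0 : R) by case: P.
case: ifP => [/andP[/properP[x wx] ww]|_]; last exact: sumr_ge0.
(* The outcome is counted at (x, x), where x is its sorted form; the other terms are nonnegative. *)
rewrite (bigD1 (x, x)) /=; last exact: eqxx.
by rewrite wx -(permPl ww) wx ler_wpDr // sumr_ge0.
Qed.

Lemma kernel_stay_diagonal (R : realFieldType) (n : nat)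
    (z : intpart n * intpart n) :
  (0 < n)%N -> diagonal z -> 1 <= \sum_(z' | diagonal z') kernel R z z'.
Proof.
move=> n0 /eqP z12; apply: le_trans (kernel_diagonal_ge R z).
rewrite /coupled_step z12 eqxx big_map /=.
have zP := intpart_proper z.2.
rewrite (eq_bigl (fun w => proper_parts n w.2)); last first.
  by move=> w; rewrite /meet_outcome /= perm_refl andbT.
rewrite -big_filter (all_filterP (proper_walk R zP)) big_cons sum_moves /stayp.
have /andP[_ /eqP ->] := zP.
suff -> : n%:R^-1 + (n%:R ^+ 2 - n%:R) / n%:R ^+ 2 = 1 :> R by [].
by field; rewrite pnatr_eq0; lia.
Qed.

(** Two entries of weight q >= 2b/n^2 are meetings: [sg] stays while [tu] splits off b, and [sg]
    merges b and c while [tu] stays. All other entries are merely nonnegative. *)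
Lemma couple_meet (R : realFieldType) (n b c : nat) (A : seq nat) :
  (0 < b <= c)%N -> (b + c <= n)%N ->
  proper_parts n [:: b, c & A] -> proper_parts n ((b + c)%N :: A) ->
  4 * b%:R / n%:R ^+ 2
    <= \sum_(w <- couple R n b c A | meet_outcome n w.2) w.1.
Proof.
move=> bc bcn sgP tuP.
have sum_ge0 (l : seq (R * (seq nat * seq nat))) :
    all (fun w => 0 <= w.1) l -> 0 <= \sum_(w <- l | meet_outcome n w.2) w.1.
  by move=> /allP l0; rewrite big_seq_cond sumr_ge0 // => w /andP[/l0].
have := all_ge0_couple R A bc bcn; have := coal_ge R bc bcn.
rewrite /couple -/(coal R n b c) !all_cat [all _ (_ :: _)]/=.
set q := coal R n b c => qge.
case/and5P=> /sum_ge0 l1 /sum_ge0 l2 /sum_ge0 l3 /sum_ge0 l4.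
case/and3P=> /sum_ge0 l5 /and3P[q0 r0 _] /andP[q1 /sum_ge0 l6].
have meet_sg : meet_outcome n ([:: b, c & A], [:: b, (b + c - b)%N & A]).
  by rewrite /meet_outcome /= addKn sgP perm_refl.
have meet_tu : meet_outcome n ((b + c)%N :: A, (b + c)%N :: A).
  by rewrite /meet_outcome /= tuP perm_refl.
rewrite !big_cat !big_cons big_nil /= meet_sg meet_tu subKr.
by case: ifP => _; rewrite natrM in qge; lra.
Qed.

Lemma meet_outcome_swap (n : nat) (u : seq nat * seq nat) :
  meet_outcome n (u.2, u.1) = meet_outcome n u.
Proof.
rewrite /meet_outcome /= perm_sym andbC [RHS]andbC.
by case: (boolP (perm_eq _ _)) => //= /perm_proper_parts ->.
Qed.

Lemma kernel_meet (R : realFieldType) (n : nat) (z : intpart n * intpart n) :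
  ~~ diagonal z ->
  4 * sdist R z.1 z.2 / n%:R ^+ 2 <= \sum_(z' | diagonal z') kernel R z z'.
Proof.
move=> zP; have zN := negPf zP; apply: le_trans (kernel_diagonal_ge R z).
rewrite /sdist /coupled_step -!val_eqE /= in zN *.
rewrite /diagonal -val_eqE in zN; rewrite zN.
case xyE : (unmerge z.1 z.2) => [[[b c] A]|].
  by have [? ? ? ?] := unmerge_proper xyE; apply: couple_meet.
case yxE : (unmerge z.2 z.1) => [[[b c] A]|].
  have [? ? ? ?] := unmerge_proper yxE; rewrite big_map /=.
  by under eq_bigl do rewrite meet_outcome_swap; apply: couple_meet.
(* Beyond distance 1, [sdist] is 0 and the bound is trivial. *)
by rewrite mulr0 mul0r big_mkcond big_seq1 /=; case: ifP; rewrite ?ler01.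
Qed.

(** * Growth of the probability of having met *)

(** As s = n/2 on the diagonal, the bracket is the contribution of uncoupled pairs to E[s];
    [kernel_meet] turns it into newly met mass. *)
Lemma Prob_diagonal_step (R : realFieldType) (n : nat)
    (z : intpart n * intpart n) (t : nat) :
  (0 < n)%N ->
  Prob R z t (@diagonal n)
    + 4 / n%:R ^+ 2 * (Expect z t (fun u => sdist R u.1 u.2)
                       - n%:R / 2 * Prob R z t (@diagonal n))
    <= Prob R z t.+1 (@diagonal n).
Proof.
move=> n0; rewrite /Prob /Expect /= exchange_big /=.
rewrite [in leRHS](bigID (@diagonal n)) /=.
rewrite [\sum_u _ * sdist _ _ _](bigID (@diagonal n)) /=.
set D := \sum_(u | _) law R z t u.
have -> : \sum_(u | diagonal u) law R z t u * sdist R u.1 u.2 = n%:R / 2 * D.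
  by rewrite mulr_sumr; apply: eq_bigr => u uD; rewrite /sdist ifT // mulrC.
rewrite addrAC subrr add0r mulr_sumr lerD //.
  apply: ler_sum => u uD; rewrite -mulr_sumr.
  by rewrite ler_peMr ?law_ge0 // kernel_stay_diagonal.
apply: ler_sum => u uD; rewrite -mulr_sumr mulrCA ler_wpM2l ?law_ge0 //.
by rewrite mulrAC kernel_meet.
Qed.

Lemma Prob_ge0 (R : realFieldType) (n : nat) (z : intpart n * intpart n)
    (t : nat) (E : pred (intpart n * intpart n)) :
  0 <= Prob R z t E.
Proof. by apply: sumr_ge0 => u _; apply: law_ge0. Qed.

(** For n <= 1 there is only one partition, so every distance is 0. The bound n >= 2 later gives 2/n
    <= 1. *)
Lemma rho1_gt1 (n : nat) (x y : intpart n) : rho x y = 1%N -> (1 < n)%N.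
Proof.
rewrite ltnNge => rho1; apply/negP => n_le1.
move: rho1; rewrite /rho; case: ex_minnP => m _ /(_ 0%N) m0 m1.
have ones (u : intpart n) : parts u = nseq n 1%N.
  have := intpart_proper u; rewrite /proper_parts; case: (parts u) => [|a s].
    by move=> /andP[_ /eqP <-].
  case: s => [|d s] /=; rewrite !inE => uP; last by lia.
  by have [-> ->] : a = 1%N /\ n = 1%N by lia.
suff /m0 : reach 0 x y by rewrite m1.
apply/existsP; exists [tuple] => /=.
by apply/eqP/val_inj; rewrite /= !ones.
Qed.

Theorem lemma17 (R : realType) (alpha beta : R)
  (alpha_gt0 : 0 < alpha) (beta_gt0 : 0 < beta)
  (Es_ge : forall (n : nat) (X0 Y0 : intpart n) (t : nat),
     rho X0 Y0 = 1%N -> alpha * n%:R <= t%:R ->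
     beta * n%:R <= Expect (X0, Y0) t (fun z => sdist R z.1 z.2)) :
  forall (n : nat) (X0 Y0 : intpart n), rho X0 Y0 = 1%N ->
    let T := (`|Num.ceil (alpha * n%:R)| + `|Num.ceil (n%:R / 2 : R)|)%N in
    beta <= Prob R (X0, Y0) T (fun z => z.1 == z.2).
Proof.
move=> n X0 Y0 rho1 /=; have n1 := rho1_gt1 rho1.
have n0 : (0 < n)%N by apply: ltnW.
have nR0 : 0 < n%:R :> R by rewrite ltr0n.
have ceil_le (x : R) : 0 <= x -> x <= `|Num.ceil x|%N%:R.
  move=> x0; rewrite natr_absz ger0_norm ?ceil_ge //.
  by rewrite -(ler_int R) (le_trans x0) ?ceil_ge.
set t0 := `|Num.ceil (alpha * _)|%N; set k := `|Num.ceil (_ / 2)|%N.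
have t0_ge : alpha * n%:R <= t0%:R by apply: ceil_le; rewrite mulr_ge0 // ltW.
have k_ge : n%:R / 2 <= k%:R :> R by apply: ceil_le; rewrite divr_ge0.
pose p j := Prob R (X0, Y0) (t0 + j) (@diagonal n).
rewrite -[Prob _ _ _ _]/(p k).
have p_step j : p j + 2 / n%:R * (2 * beta - p j) <= p j.+1.
  rewrite /p addnS; apply: le_trans (Prob_diagonal_step R _ _ n0).
  rewrite -/(p j) lerD2l.
  have Es : beta * n%:R <= Expect (X0, Y0) (t0 + j) (fun u => sdist R u.1 u.2).
    by apply: Es_ge; rewrite // natrD (le_trans t0_ge) ?lerDl.
  have -> : 2 / n%:R * (2 * beta - p j)
            = 4 / n%:R ^+ 2 * (beta * n%:R - n%:R / 2 * p j).
    by field; rewrite gt_eqF.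
  by rewrite ler_wpM2l ?divr_ge0 ?exprn_ge0 // lerD2r.
pose x : R := 2 / n%:R.
have x0 : 0 <= x by rewrite divr_ge0.
have x1 : x <= 1 by rewrite ler_pdivrMr // mul1r ler_nat.
(* Below beta, 2 beta - p > beta yields a gain of at least x beta. Once p >= beta it stays so: the
   lower bound (1 - x) p + 2 x beta is at least beta because 0 <= x <= 1. *)
have p_ge j : beta <= p j \/ j%:R * x * beta <= p j.
  elim: j => [|j IH]; first by right; rewrite mul0r mul0r Prob_ge0.
  have := p_step j; rewrite -/x -[j.+1]addn1 natrD.
  by have [pj|pj] := lerP beta (p j); [left | right; case: IH]; nra.
(* In the second case k >= n/2 gives k x >= 1. *)
case: (p_ge k) => //; apply: le_trans; apply: ler_peMl (ltW beta_gt0) _.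
by rewrite /x mulrA ler_pdivlMr // mul1r -ler_pdivrMr.
Qed.
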